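(* There exists a singular inner function $S=S_\nu$ in the unit disc $\mathbb D$ satisfying the weighted area condition $(A)$, that is, such that for every $\varepsilon\in(0,1)$, $$\int_{\{z\in\mathbb D:\,|S(z)|<\varepsilon\}}\frac{dm_2(z)}{1-|z|}=+\infty .$$ Therefore, there is no Blaschke product $B$ such that $BS$ is a generalized Carleson--Newman inner function.
   Context: Let $\mathbb D=\{z\in\mathbb C:|z|<1\}$, $\mathbb T=\partial\mathbb D$, and let $m_2$ denote planar Lebesgue measure. For a finite positive Borel measure $\nu$ on $\mathbb T$ that is singular with respect to Lebesgue measure, $S_\nu(z)=\exp\bigl(-\int_{\mathbb T}\frac{\zeta+z}{\zeta-z}\,d\nu(\zeta)\bigr)$, $z\in\mathbb D$, is the associated singular inner function. The pseudo-hyperbolic distance is $\rho(z,w)=\frac{|z-w|}{|1-\bar z w|}$ for $z,w\in\mathbb D$. For an inner function $\Theta$ in $\mathbb D$, $Z(\Theta)$ denotes its zero set in $\mathbb D$, and $\rho(\lambda,Z(\Theta))=\inf\{\rho(\lambda,w):w\in Z(\Theta)\}$ (with $\inf\emptyset=+\infty$). An inner function $\Theta$ is called a generalized Carleson--Newman inner function (equivalently, satisfies the weak embedding property, WEP) if for every $\varepsilon>0$ there exists $\delta>0$ such that for all $\lambda\in\mathbb D$, $|\Theta(\lambda)|<\delta$ implies $\rho(\lambda,Z(\Theta))<\varepsilon$. *)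

(* Defs.v *)
From HB Require Import structures.
From mathcomp Require Import all_boot all_order all_algebra.
From mathcomp Require Import complex.
From mathcomp Require Import all_classical all_reals all_analysis.
Set Implicit Arguments.
Unset Strict Implicit.
Unset Printing Implicit Defensive.
Import Order.TTheory GRing.Theory Num.Theory.
Import numFieldNormedType.Exports.
Local Open Scope classical_set_scope.
Local Open Scope ring_scope.
Local Open Scope complex_scope.

(* Measures live on the Borel plane R * R, whose points are read as complex
   numbers through [toC].  Functions of a complex variable are total functions
   on R[i] of which only the values on the unit disc matter. *)

Notation plane R := (measurableTypeR R * measurableTypeR R)%type.

Definition toC {R : realType} (p : plane R) : R[i] := p.1 +i* p.2.

Definition m2 {R : realType} : {measure set (plane R) -> \bar R} :=
  (@lebesgue_measure R \x @lebesgue_measure R)%E.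

(* The modulus with values in R; the norm of R[i] itself is R[i]-valued. *)
Definition cabs {R : realType} (z : R[i]) : R := `|z : Rcomplex R|.

Definition cexp {R : realType} (z : R[i]) : R[i] :=
  (expR (complex.Re z) * cos (complex.Im z)) +i*
  (expR (complex.Re z) * sin (complex.Im z)).

Definition disc {R : realType} : set R[i] := [set z | cabs z < 1].

Definition circle {R : realType} : set (plane R) := [set p | cabs (toC p) = 1].

(* The image of Lebesgue measure on [0, 2 pi[ under t |-> exp(i t). *)
Definition arclength {R : realType} (A : set (plane R)) : \bar R :=
  @lebesgue_measure R
    (`[0, 2 * pi[ `&` [set t | A (cos t, sin t)]).

Definition mutually_singular {d : measure_display} {T : measurableType d}
    {R : realType} (mu nu : set T -> \bar R) : Prop :=
  exists A : set T,
    [/\ measurable A, mu A = 0%E & nu (~` A) = 0%E].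

(* A Borel measure on the unit circle is a Borel measure on the plane that
   vanishes off the circle. *)
Definition singular_on_circle {R : realType}
    (nu : {finite_measure set (plane R) -> \bar R}) : Prop :=
  nu (~` circle) = 0%E /\ mutually_singular arclength nu.

Definition cintegral {R : realType} (nu : {measure set (plane R) -> \bar R})
    (D : set (plane R)) (f : plane R -> R[i]) : R[i] :=
  (\int[nu]_(p in D) complex.Re (f p)) +i*
  (\int[nu]_(p in D) complex.Im (f p)).

Definition singular_inner {R : realType}
    (nu : {finite_measure set (plane R) -> \bar R}) (z : R[i]) : R[i] :=
  cexp (- cintegral nu circle (fun p => (toC p + z) / (toC p - z))).

Definition blaschke_factor {R : realType} (a z : R[i]) : R[i] :=
  if a == 0 then z else `|a| / a * ((a - z) / (1 - a^* * z)).

(* Zeros are listed with multiplicity; the number of zeros is finite (possibly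
   none) or infinite, and a unimodular constant factor is allowed. *)
Definition is_blaschke_product {R : realType} (B : R[i] -> R[i]) : Prop :=
  exists2 c : R[i], cabs c = 1 &
    (exists2 s : seq R[i], (forall a, a \in s -> disc a) &
       forall z, disc z -> B z = c * \prod_(a <- s) blaschke_factor a z) \/
    (exists2 a : nat -> R[i],
       (forall n, disc (a n)) /\
       (\sum_(0 <= n <oo) (1 - cabs (a n))%:E < +oo)%E &
       forall z, disc z ->
         ((fun n => c * \prod_(0 <= k < n) blaschke_factor (a k) z)
            : nat -> R[i]^o) @ \oo --> (B z : R[i]^o)).

(* [derivable _ z 1] over the field of scalars R[i] is complex
   differentiability at z. *)
Definition holomorphic_on_disc {R : realType} (f : R[i] -> R[i]) : Prop :=
  forall z, disc z -> derivable (f : R[i]^o -> R[i]^o) z 1.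

Definition is_inner {R : realType} (Theta : R[i] -> R[i]) : Prop :=
  [/\ holomorphic_on_disc Theta,
      forall z, disc z -> cabs (Theta z) <= 1 &
      \forall p \ae @arclength R, exists2 w : R[i], cabs w = 1 &
        (Theta (r%:C * toC p) : R[i]^o) @[r --> (1 : R)^'-] --> (w : R[i]^o)].

Definition zero_set {R : realType} (Theta : R[i] -> R[i]) : set R[i] :=
  [set z | disc z /\ Theta z = 0].

Definition pseudo_hyp {R : realType} (z w : R[i]) : R :=
  cabs (z - w) / cabs (1 - z^* * w).

(* [ereal_inf set0 = +oo], as wanted when Z is empty. *)
Definition pseudo_hyp_set {R : realType} (z : R[i]) (Z : set R[i]) : \bar R :=
  ereal_inf [set (pseudo_hyp z w)%:E | w in Z].

Definition generalized_Carleson_Newman {R : realType} (Theta : R[i] -> R[i])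
    : Prop :=
  is_inner Theta /\
  forall eps : R, 0 < eps -> exists2 delta : R, 0 < delta &
    forall l : R[i], disc l -> cabs (Theta l) < delta ->
      (pseudo_hyp_set l (zero_set Theta) < eps%:E)%E.

Definition area_condition {R : realType} (S : R[i] -> R[i]) : Prop :=
  forall eps : R, 0 < eps < 1 ->
    (\int[m2]_(p in [set p | disc (toC p) /\ (cabs (S (toC p)) < eps)%R])
       ((1 - cabs (toC p))^-1)%:E = +oo)%E.

(* Main.v *)
Require Import Defs.
From HB Require Import structures.
From mathcomp Require Import all_boot all_order all_algebra.
From mathcomp Require Import complex ring lra zify.
From mathcomp Require Import all_classical all_reals all_analysis.
From mathcomp Require Import measurable_realfun.
Set Implicit Arguments.
Unset Strict Implicit.
Unset Printing Implicit Defensive.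
Import Order.TTheory GRing.Theory Num.Theory.
Import numFieldNormedType.Exports.
Local Open Scope classical_set_scope.
Local Open Scope ring_scope.
Local Open Scope complex_scope.

(** The measure nu is the image of Lebesgue measure on [0, 1/2[ under a
countably valued map onto the circle: t is sent to the point of abscissa
[t ^ 2] rounded down to a multiple of some [1/N], where [N > exp (1 / t^2)].
Thus nu is purely atomic, hence singular.  Its density in abscissa x, when
smoothed at a scale above [exp (- 1/x)], is about [x ^ (-1/2)], which is
unbounded near 0.  So on the boxes "abscissa about 1/n, height about [2^-n]"
the Poisson integral of nu is at least a constant times [sqrt n], and |S| is
small there; each of these disjoint boxes contributes about [1/n] to the
weighted area, and the harmonic series diverges.

If BS were generalized Carleson-Newman, then since |B| <= 1 and S has no zeros,
the set where |S| is small would be covered by the pseudo-hyperbolic discs of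
radius 1/4 around the zeros of B.  The disc around w contributes at most
[12 (1 - |w|)] to the weighted area, and the Blaschke condition makes the sum of
these finite, contradicting the area condition. *)

(** * The modulus and Blaschke factors *)

Section modulus.
Context {R : realType}.
Implicit Types z w a : R[i].

Lemma cabsE z : cabs z = Num.sqrt (complex.Re z ^+ 2 + complex.Im z ^+ 2).
Proof. by case: z. Qed.

Lemma cabs_ge0 z : 0 <= cabs z. Proof. exact: normr_ge0. Qed.

Lemma cabs_sqr z : cabs z ^+ 2 = complex.Re z ^+ 2 + complex.Im z ^+ 2.
Proof. by rewrite cabsE sqr_sqrtr// addr_ge0// sqr_ge0. Qed.

Lemma normCE z : `|z| = (cabs z)%:C.
Proof. by rewrite normc_def cabsE. Qed.

Lemma cabsM z w : cabs (z * w) = cabs z * cabs w.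
Proof. exact: Normc.normcM. Qed.

Lemma cabsV z : cabs z^-1 = (cabs z)^-1.
Proof. exact: Normc.normcV. Qed.

Lemma cabs1 : cabs (1 : R[i]) = 1.
Proof. exact: Normc.normc1. Qed.

Lemma cabs_eq0 z : (cabs z == 0) = (z == 0).
Proof. exact: (@normr_eq0 _ (Rcomplex R)). Qed.

Lemma cabsB z w : cabs (z - w) = cabs (w - z).
Proof. exact: (@distrC _ (Rcomplex R)). Qed.

Lemma ler_cabsD z w : cabs (z + w) <= cabs z + cabs w.
Proof. exact: (@ler_normD _ (Rcomplex R)). Qed.

Lemma ler_cabs_sub z w : cabs z - cabs w <= cabs (z - w).
Proof. exact: (@lerB_dist _ (Rcomplex R)). Qed.

Lemma conjCE z : Num.conj z = conjc z. Proof. by []. Qed.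

Lemma cabsJ z : cabs (Num.conj z) = cabs z.
Proof. by case: z => x y; rewrite conjCE !cabsE /= sqrrN. Qed.

Lemma cabs_norm z : cabs `|z| = cabs z.
Proof.
by rewrite normCE !cabsE/= expr0n addr0 sqrtr_sqr ger0_norm ?sqrtr_ge0.
Qed.

Lemma ler_Re_cabs z : `|complex.Re z| <= cabs z.
Proof.
by rewrite cabsE -sqrtr_sqr ler_sqrt ?addr_ge0 ?sqr_ge0// lerDl sqr_ge0.
Qed.

Lemma ler_Im_cabs z : `|complex.Im z| <= cabs z.
Proof.
by rewrite cabsE -sqrtr_sqr ler_sqrt ?addr_ge0 ?sqr_ge0// lerDr sqr_ge0.
Qed.

Lemma cabs_cexp z : cabs (cexp z) = expR (complex.Re z).
Proof.
rewrite cabsE/= !exprMn -mulrDr cos2Dsin2 mulr1 sqrtr_sqr.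
by rewrite ger0_norm// expR_ge0.
Qed.

Lemma cexp_neq0 z : cexp z != 0.
Proof. by rewrite -cabs_eq0 cabs_cexp gt_eqF// expR_gt0. Qed.

(** Divided by [cabs (1 - Num.conj a * z) ^+ 2], this is the classical formula for 1 - |b|^2 with b
    a Blaschke factor; both bounds on [blaschke_factor] below come from it. *)
Lemma cabs_1subJM a z :
  cabs (1 - Num.conj a * z) ^+ 2 - cabs (a - z) ^+ 2 =
  (1 - cabs a ^+ 2) * (1 - cabs z ^+ 2).
Proof. by rewrite conjCE !cabs_sqr; case: a z => [a1 a2] [z1 z2] /=; ring. Qed.

Lemma cabs_1subJM_gt0 a z : cabs a <= 1 -> cabs z < 1 ->
  0 < 1 - cabs z <= cabs (1 - Num.conj a * z).
Proof.
move=> a1 z1; rewrite subr_gt0 z1/=.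
apply: le_trans (ler_cabs_sub _ _); rewrite cabs1 lerB// cabsM cabsJ.
by rewrite -[leRHS]mul1r ler_wpM2r ?cabs_ge0.
Qed.

Lemma cabs_blaschke_factor a z :
  cabs (blaschke_factor a z) = cabs (a - z) / cabs (1 - Num.conj a * z).
Proof.
rewrite /blaschke_factor; case: eqVneq => [->|a0].
  by rewrite rmorph0 mul0r subr0 sub0r cabs1 divr1 -[- z]sub0r cabsB subr0.
by rewrite !cabsM !cabsV cabs_norm divff ?mul1r// cabs_eq0.
Qed.

Lemma cabs_blaschke_factor_le1 a z : cabs a < 1 -> cabs z < 1 ->
  cabs (blaschke_factor a z) <= 1.
Proof.
move=> a1 z1; have /andP[d0 dle] := cabs_1subJM_gt0 (ltW a1) z1.
have d1 := lt_le_trans d0 dle.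
rewrite cabs_blaschke_factor ler_pdivrMr// mul1r.
rewrite -(@ler_pXn2r _ 2) ?nnegrE ?cabs_ge0// -subr_ge0 cabs_1subJM.
by rewrite mulr_ge0// subr_ge0 expr_le1 ?cabs_ge0 // ltW.
Qed.

(** Since |b| <= 1, |b| >= |b|^2 = 1 - (1 - |a|^2)(1 - |z|^2) / |1 - conj(a) z|^2. Here 1 - |a|^2 <=
    2 (1 - |a|) and the denominator is at least (1 - |z|)^2, so the loss is a constant depending
    only on z times the Blaschke term of a. *)
Lemma cabs_blaschke_factor_ge a z : cabs a < 1 -> cabs z < 1 ->
  1 - 2 / (1 - cabs z) ^+ 2 * (1 - cabs a) <= cabs (blaschke_factor a z).
Proof.
move=> a1 z1; have b1 := cabs_blaschke_factor_le1 a1 z1.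
apply: (@le_trans _ _ (cabs (blaschke_factor a z) ^+ 2)); last first.
  by rewrite expr2 ler_piMl ?cabs_ge0.
have /andP[d0 dle] := cabs_1subJM_gt0 (ltW a1) z1.
have d1 := lt_le_trans d0 dle.
rewrite cabs_blaschke_factor expr_div_n.
have -> : cabs (a - z) ^+ 2 =
    cabs (1 - Num.conj a * z) ^+ 2 - (1 - cabs a ^+ 2) * (1 - cabs z ^+ 2).
  by rewrite -cabs_1subJM; ring.
rewrite mulrBl divff ?expf_neq0 ?gt_eqF// lerB//.
have a0 := cabs_ge0 a; have z0 := cabs_ge0 z.
have A : 0 <= 1 - cabs a ^+ 2 <= 2 * (1 - cabs a) by apply/andP; split; nra.
have Z : 0 <= 1 - cabs z ^+ 2 <= 1 by apply/andP; split; nra.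
rewrite [leRHS]mulrAC; apply: ler_pM.
- by nra.
- by rewrite invr_ge0 exprn_ge0// ltW.
- by nra.
- by rewrite lef_pV2 ?posrE ?exprn_gt0// ler_pXn2r ?nnegrE// ltW.
Qed.

Lemma cabs_blaschke_factor_eq0 a z : cabs a < 1 -> cabs z < 1 ->
  cabs (blaschke_factor a z) = 0 -> z = a.
Proof.
move=> a1 z1; have /andP[d0 dle] := cabs_1subJM_gt0 (ltW a1) z1.
have d1 := lt_le_trans d0 dle.
rewrite cabs_blaschke_factor => /eqP.
rewrite mulf_eq0 invr_eq0 (gt_eqF d1) orbF cabs_eq0 subr_eq0.
by move=> /eqP.
Qed.

Lemma cabs_prod (I : Type) (s : seq I) (P : pred I) (F : I -> R[i]) :
  cabs (\prod_(i <- s | P i) F i) = \prod_(i <- s | P i) cabs (F i).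
Proof.
elim: s => [|i s IH]; first by rewrite !big_nil cabs1.
by rewrite !big_cons; case: ifP => // _; rewrite cabsM IH.
Qed.

End modulus.

(** * Zeros of Blaschke products *)

(** Weierstrass product inequality; in the induction, (1 - x)(1 - s) >= 1 - x - s because x s >=
    0. *)
Lemma prod_1B_ge (R : realDomainType) (x : nat -> R) m n :
  (forall k, 0 <= x k <= 1) ->
  1 - \sum_(m <= k < n) x k <= \prod_(m <= k < n) (1 - x k).
Proof.
move=> x01; have [nm|/ltnW mn] := leqP n m.
  by rewrite !big_geq// subr0.
elim: n mn => [|n IH].
  by rewrite leqn0 => /eqP->; rewrite !big_geq// subr0.
rewrite leq_eqVlt => /predU1P[->|]; first by rewrite !big_geq// subr0.
rewrite ltnS => mn; rewrite !big_nat_recr//=.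
have S0 : 0 <= \sum_(m <= i < n) x i.
  by apply: sumr_ge0 => k _; have /andP[] := x01 k.
have := IH mn; have /andP[] := x01 n.
set s := \sum_(_ <= _ < _) _ in S0 *; set p := \prod_(_ <= _ < _) _.
by move=> *; nra.
Qed.

Lemma prodr_le1 (R : numDomainType) (I : Type) (s : seq I) (P : pred I)
    (F : I -> R) :
  (forall i, P i -> 0 <= F i <= 1) -> \prod_(i <- s | P i) F i <= 1.
Proof.
move=> F01; have /andP[] // : 0 <= \prod_(i <- s | P i) F i <= 1.
elim/big_ind : _ => //; first by rewrite ler01 lexx.
by move=> x y /andP[x0 x1] /andP[y0 y1]; rewrite mulr_ge0//= mulr_ile1.
Qed.

Section blaschke.
Context {R : realType}.
Implicit Types z w a : R[i].

Lemma cvg_cabs (u : nat -> R[i]) (l : R[i]) :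
  (u : nat -> R[i]^o) @ \oo --> (l : R[i]^o) ->
  forall e : R, 0 < e -> \forall n \near \oo, cabs (l - u n) < e.
Proof.
move=> /cvgrPdist_lt cul e e0.
have := cul e%:C; rewrite ltcR => /(_ e0).
by apply: filterS => n; rewrite normCE ltcR.
Qed.

Lemma cabs_blaschke_le1 B z : is_blaschke_product B -> disc z ->
  cabs (B z) <= 1.
Proof.
move=> [c c1 [[s sD Bz]|[a [aD _ Bz]]]] z1.
  rewrite Bz// cabsM c1 mul1r cabs_prod big_seq prodr_le1// => k ks.
  by rewrite cabs_ge0/= cabs_blaschke_factor_le1//; exact: sD.
apply/ler_addgt0Pr => e e0.
have [N _ /(_ N (leqnn N))] := cvg_cabs (Bz _ z1) e0.
set P := c * _ => PN; have : cabs P <= 1.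
  rewrite cabsM c1 mul1r cabs_prod prodr_le1// => k _.
  by rewrite cabs_ge0/= cabs_blaschke_factor_le1//; exact: aD.
have := ler_cabs_sub (B z) P; lra.
Qed.

(** Cut the product at an N beyond which the Blaschke sum is below 1 / (2C), C being the constant of
    [cabs_blaschke_factor_ge]. The tail product is then at least 1/2 by [prod_1B_ge], and the head
    is a fixed positive number because z is none of the a n. *)
Lemma cabs_blaschke_prod_lb (a : nat -> R[i]) z :
  (forall n, disc (a n)) ->
  (\sum_(0 <= n <oo) (1 - cabs (a n))%:E < +oo)%E ->
  disc z -> (forall n, z <> a n) ->
  exists2 e : R, 0 < e &
    \forall n \near \oo, e <= cabs (\prod_(0 <= k < n) blaschke_factor (a k) z).
Proof.
move=> aD sa z1 za.
pose C := 2 / (1 - cabs z) ^+ 2.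
have C0 : 0 < C by rewrite divr_gt0// exprn_gt0// subr_gt0.
have a0 k : 0 <= 1 - cabs (a k) by rewrite subr_ge0 ltW//; exact: aD.
have [N tailN] : exists N,
    (\sum_(N <= n <oo) (1 - cabs (a n))%:E < (2 * C)^-1%:E)%E.
  have e0 : 0 < (2 * C)^-1 by rewrite invr_gt0 mulr_gt0.
  have := nneseries_tail_cvg sa (fun k _ => a0 k).
  move=> /(_ [set x | (x < (2 * C)^-1%:E)%E]) [|N _ /(_ N (leqnn N))];
    last by exists N.
  by apply: (@nbhs_open_ereal_lt _ 0%R (fun=> (2 * C)^-1)).
have b1 k : 0 <= cabs (blaschke_factor (a k) z) <= 1.
  by rewrite cabs_ge0/= cabs_blaschke_factor_le1//; exact: aD.
exists ((\prod_(0 <= k < N) cabs (blaschke_factor (a k) z)) / 2).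
  rewrite divr_gt0// prodr_gt0// => k _; rewrite lt_neqAle cabs_ge0 andbT.
  apply/negP => /eqP/esym/(cabs_blaschke_factor_eq0 (aD k) z1); exact: za.
exists N => // n/= Nn.
rewrite cabs_prod (big_cat_nat _ Nn)//= ler_wpM2l//.
  by apply: prodr_ge0 => k _; exact: cabs_ge0.
have b1' k : 0 <= 1 - cabs (blaschke_factor (a k) z) <= 1.
  by have := b1 k; lra.
have := prod_1B_ge N n b1'.
under [in X in _ <= X]eq_bigr do rewrite subKr.
set S := \sum_(_ <= _ < _) _ => H.
suff : S <= 2^-1.
  move=> S2; have := H; lra.
apply: (@le_trans _ _ (C * \sum_(N <= k < n) (1 - cabs (a k)))).
  rewrite mulr_sumr; apply: ler_sum => k _.
  by rewrite lerBlDr addrC -lerBlDr cabs_blaschke_factor_ge//; exact: aD.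
have : ((\sum_(N <= k < n) (1 - cabs (a k)))%:E <= (2 * C)^-1%:E)%E.
  rewrite -sumEFin; apply: le_trans (ltW tailN).
  by apply: nneseries_lim_ge => k _ _; exact: a0.
rewrite lee_fin invfM => h.
by rewrite -ler_pdivlMl// mulrC.
Qed.

(** One format for both kinds of product: a finite list of zeros is padded with the point 1, which
    adds 0 to the Blaschke sum; hence the non-strict bound on [cabs (a n)]. For infinite products,
    partial products bounded away from 0 cannot tend to 0. *)
Lemma blaschke_zeros B : is_blaschke_product B -> exists a : nat -> R[i],
  [/\ forall n, cabs (a n) <= 1,
      (\sum_(0 <= n <oo) (1 - cabs (a n))%:E < +oo)%E &
      forall z, disc z -> B z = 0 -> exists n, z = a n].
Proof.
move=> [c c1 [[s sD Bz]|[a [aD sa Bz]]]].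
  have s1 n : cabs (nth 1 s n) <= 1.
    have [ns|sn] := ltnP n (size s); last by rewrite nth_default// cabs1.
    by rewrite ltW//; apply: sD; exact: mem_nth.
  exists (nth 1 s); split => //.
    rewrite (nneseries_split 0 (size s)); last first.
      by move=> k _; rewrite lee_fin subr_ge0.
    rewrite [X in (_ + X)%E]eseries0 ?adde0; last first.
      by move=> k sk _; rewrite nth_default ?cabs1 ?subrr.
    by rewrite sumEFin ltry.
  move=> z z1; rewrite Bz// => /eqP; rewrite mulf_eq0.
  have -> /= : (c == 0) = false by rewrite -cabs_eq0 c1 oner_eq0.
  rewrite prodf_seq_eq0 => /hasP[w ws /= /eqP w0].
  exists (index w s); rewrite nth_index//.
  apply: cabs_blaschke_factor_eq0 => //; first exact: sD.
  by apply/eqP; rewrite cabs_eq0 w0.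
exists a; split => //; first by move=> n; rewrite ltW//; exact: aD.
move=> z z1 Bz0; apply: contrapT => /forallNP za.
have [e e0 [N1 _ he]] := cabs_blaschke_prod_lb aD sa z1 za.
have [N2 _ h2] := cvg_cabs (Bz _ z1) e0.
have := he (maxn N1 N2) (leq_maxl _ _); have := h2 (maxn N1 N2) (leq_maxr _ _).
by rewrite cabsB Bz0 subr0 cabsM c1 mul1r; lra.
Qed.

End blaschke.

(* The integral of a nonnegative function is a supremum over simple functions
   below it, so it is monotone even on non-measurable sets and functions. *)
Lemma ge0_le_integral_nonmeasurable d (T : measurableType d) (R : realType)
    (mu : {measure set T -> \bar R}) (D E : set T) (f g : T -> \bar R) :
  (forall x, D x -> 0 <= f x)%E -> (forall x, E x -> 0 <= g x)%E ->
  D `<=` E -> (forall x, D x -> f x <= g x)%E ->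
  (\int[mu]_(x in D) f x <= \int[mu]_(x in E) g x)%E.
Proof.
move=> f0 g0 DE fg; rewrite !ge0_integralE//.
apply: ub_ereal_sup => _ [h /= hf <-]; apply: ereal_sup_ubound.
exists h => // x; apply: le_trans (hf x) _; rewrite /patch.
case: ifPn => [/[!inE] Dx|_]; first by rewrite ifT ?fg// inE; exact: DE.
by case: ifPn => // /[!inE] /g0.
Qed.

(** * Covering by pseudo-hyperbolic discs *)

Section covering.
Context {R : realType}.
Implicit Types z w : R[i].

(** From 1 - conj(z) w = (1 - |w|^2) + (conj(w) - conj(z)) w, the distance d = |z - w| satisfies 4 d
    < (1 - |w|^2) + d, so d < (2/3)(1 - |w|). The triangle inequality then leaves 1 - |z| > (1/3)(1
    - |w|). *)
Lemma pseudo_hyp_ball z w : cabs z < 1 -> cabs w < 1 -> pseudo_hyp z w < 4^-1 ->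
  cabs (z - w) < 1 - cabs w /\ 1 - cabs w < 3 * (1 - cabs z).
Proof.
move=> z1 w1; have /andP[d0 dle] := cabs_1subJM_gt0 (ltW z1) w1.
have D0 := lt_le_trans d0 dle; rewrite /pseudo_hyp ltr_pdivrMr// => h.
have : cabs (1 - Num.conj z * w) <= (1 - cabs w ^+ 2) + cabs (z - w).
  have -> : 1 - Num.conj z * w =
      (1 - Num.conj w * w) + (Num.conj w - Num.conj z) * w.
    by ring.
  apply: le_trans (ler_cabsD _ _) _; apply: lerD.
    have -> : 1 - Num.conj w * w = (1 - cabs w ^+ 2)%:C.
      rewrite cabs_sqr conjCE; case: (w) => x y /=.
      by apply/eqP; rewrite eq_complex /=; apply/andP; split; apply/eqP; ring.
    rewrite cabsE/= expr0n addr0 sqrtr_sqr ger0_norm//.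
    by rewrite subr_ge0 expr_le1 ?cabs_ge0// ltW.
  rewrite cabsM -rmorphB cabsJ cabsB -[leRHS]mulr1 ler_wpM2l ?cabs_ge0//.
  exact: ltW.
have := cabs_ge0 w; have := ler_cabs_sub z w.
by move=> *; split; nra.
Qed.

(** A square around the Euclidean disc supplied by [pseudo_hyp_ball]; being a product of intervals,
    it has an immediate area. *)
Let sq (w : R[i]) : set (plane R) :=
  [set x | `|x - complex.Re w| <= 1 - cabs w] `*`
  [set y | `|y - complex.Im w| <= 1 - cabs w].

Let itv_dist (x r : R) : [set y | `|y - x| <= r] = `[x - r, x + r]%classic.
Proof. by apply/seteqP; split => y /=; rewrite in_itv/= ler_distl. Qed.

Let measurable_sq w : measurable (sq w).
Proof.
by apply: measurableX; rewrite itv_dist; exact: measurable_itv.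
Qed.

Let m2_sq w : cabs w <= 1 -> (m2 (sq w) = (4 * (1 - cabs w) ^+ 2)%:E)%E.
Proof.
move=> w1; rewrite /sq !itv_dist.
set I := (X in X `*` _); set J := (X in _ `*` X).
transitivity (lebesgue_measure I * lebesgue_measure J)%E.
  by apply: product_measure1E; exact: measurable_itv.
rewrite !lebesgue_measure_itv /= !lte_fin.
have [w1'|] := ltP (cabs w) 1.
  rewrite !ifT; [|lra..].
  by rewrite -!EFinD -EFinM; congr EFin; ring.
move=> w1'; have -> : cabs w = 1 by apply/eqP; rewrite eq_le w1 w1'.
by rewrite !subrr !subr0 !addr0 !ltxx mul0e expr0n/= mulr0.
Qed.

(** On A the weight is dominated by the sum over n of 3 / (1 - |a n|) times the indicator of the
    square around a n. That square has area 4 (1 - |a n|)^2, so the n-th term integrates to 12 (1 -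
    |a n|). *)
Lemma integral_pseudo_hyp_cover (a : nat -> R[i]) (A : set (plane R)) :
  (forall n, cabs (a n) <= 1) ->
  (\sum_(0 <= n <oo) (1 - cabs (a n))%:E < +oo)%E ->
  (forall p, A p -> disc (toC p) /\
     exists n, disc (a n) /\ pseudo_hyp (toC p) (a n) < 4^-1) ->
  (\int[m2]_(p in A) ((1 - cabs (toC p))^-1)%:E < +oo)%E.
Proof.
move=> a1 sa Aa.
pose g n (p : plane R) := ((3 / (1 - cabs (a n)))%:E * (\1_(sq (a n)) p)%:E)%E.
have c0 n : 0 <= 3 / (1 - cabs (a n)) by rewrite divr_ge0// subr_ge0.
have g0 n p : (0 <= g n p)%E by rewrite /g -EFinM lee_fin mulr_ge0.
have mg n : measurable_fun setT (g n).
  by apply: emeasurable_funM => //; apply/measurable_EFinP.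
apply: (@le_lt_trans _ _ (\int[m2]_p (\sum_(n <oo) g n p))%E).
  apply: ge0_le_integral_nonmeasurable => //.
  - by move=> p /Aa[p1 _]; rewrite lee_fin invr_ge0 subr_ge0 ltW.
  - by move=> p _; apply: nneseries_ge0 => n _ _.
  - move=> p /Aa[p1 [n [an1 pn]]].
    apply: (@le_trans _ _ (g n p)); last first.
      apply: (@le_trans _ _ (\sum_(0 <= k < n.+1) g k p)%E); last first.
        by apply: nneseries_lim_ge => k _ _.
      by rewrite big_nat_recr//= leeDr// sume_ge0.
    have [h1 h2] := pseudo_hyp_ball p1 an1 pn.
    rewrite /g indicE mem_set ?mulr1 ?mule1; last first.
      split => /=; rewrite (le_trans _ (ltW h1))//.
        by apply: le_trans (ler_Re_cabs _); case: (a n).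
      by apply: le_trans (ler_Im_cabs _); case: (a n).
    have z0 : 0 < 1 - cabs (toC p) by rewrite subr_gt0.
    have w0 : 0 < 1 - cabs (a n) by rewrite subr_gt0.
    by rewrite lee_fin ler_pdivlMr// mulrC ler_pdivrMr// ltW.
rewrite integral_nneseries//.
apply: (@le_lt_trans _ _ (\sum_(n <oo) (12%:E * (1 - cabs (a n))%:E))%E).
  apply: lee_nneseries => [n _ _|n _]; first exact: integral_ge0.
  rewrite ge0_integralZl_EFin//; last by apply/measurable_EFinP.
  rewrite integral_indic// setIT m2_sq// -!EFinM lee_fin.
  (* For a padding point on the circle the convention 0^-1 = 0 makes both sides vanish. *)
  have [->|w0] := eqVneq (cabs (a n)) 1.
    by rewrite subrr invr0 !mulr0 mul0r.
  have {}w0 : 1 - cabs (a n) != 0 by rewrite subr_eq0 eq_sym.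
  rewrite le_eqVlt; apply/orP; left; apply/eqP; field.
  by [].
rewrite nneseriesZl; last by move=> n _; rewrite lee_fin subr_ge0.
by rewrite lte_mul_pinfty.
Qed.

Lemma not_generalized_Carleson_Newman (B S : R[i] -> R[i]) :
  is_blaschke_product B -> (forall z, S z != 0) -> area_condition S ->
  ~ generalized_Carleson_Newman (fun z => B z * S z).
Proof.
move=> BB S0 AS [_ /(_ 4^-1)[|d d0 hd]]; first by rewrite invr_gt0.
have [a [a1 sa Ba]] := blaschke_zeros BB.
(* The level must be at most d, to force |BS| < d, and below 1, for the area condition to apply. *)
have e01 : 0 < Num.min d 2^-1 < 1.
  by rewrite lt_min d0 invr_gt0 ltr0n/= gt_min invf_lt1 ?ltr1n ?orbT.
have := AS _ e01; apply/eqP; rewrite lt_eqF//.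
apply: (integral_pseudo_hyp_cover a1 sa) => p /= [p1 Sp]; split => //.
have : cabs (B (toC p) * S (toC p)) < d.
  rewrite cabsM; apply: le_lt_trans (_ : cabs (S (toC p)) < d).
    by rewrite -[leRHS]mul1r ler_wpM2r ?cabs_ge0// cabs_blaschke_le1.
  by move: Sp; rewrite lt_min => /andP[].
move=> /(hd _ p1) /ereal_inf_lt [_ [w [w1 /eqP BSw] <-]]; rewrite lte_fin => pw.
have [n wn] : exists n, w = a n.
  apply: Ba => //; apply/eqP.
  by move: BSw; rewrite mulf_eq0 (negbTE (S0 w)) orbF.
by exists n; rewrite -wn.
Qed.

End covering.

(** * The singular measure *)

Lemma measurable_fun_floor d (T : measurableType d) (R : realType)
    (f : T -> R) :
  measurable_fun setT f ->
  measurable_fun setT (fun x => (Num.floor (f x))%:~R : R).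
Proof.
move=> mf; pose fl (y : R) : R := (Num.floor y)%:~R.
suff mfl : measurable_fun setT fl by exact: (measurableT_comp mfl mf).
apply: (measurability _ (RGenCInfty.measurableE R)) => _ [_ [r ->] <-].
rewrite setTI (_ : _ @^-1` _ = `[(Num.ceil r)%:~R, +oo[%classic).
  exact: measurable_itv.
apply/seteqP; split => y /=; rewrite !in_itv/= !andbT /fl.
  by rewrite -ceil_le_int -floor_ge_int.
by rewrite -floor_ge_int -ceil_le_int.
Qed.

Lemma ge0_measurable_funV d (T : measurableType d) (R : realType) (f : T -> R) :
  measurable_fun setT f -> (forall x, 0 <= f x) ->
  measurable_fun setT (fun x => (f x)^-1).
Proof.
move=> mf f0; under eq_fun do rewrite -powR_inv1//.
exact: (measurableT_comp (measurable_powR _) mf).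
Qed.

Section curve.
Context {R : realType}.
Implicit Types t x u : R.

(** The N of the grid of multiples of 1/N used at parameter t. Adding 1 to the floor makes N
    strictly larger than exp (1 / t^2), hence positive. *)
Definition step_count t : R := (Num.floor (expR (t ^+ 2)^-1))%:~R + 1.

Definition step t : R :=
  (Num.floor (t ^+ 2 * step_count t))%:~R / step_count t.

Definition circle_graph x : plane R := (x, Num.sqrt (1 - x ^+ 2)).

Definition curve t : plane R := circle_graph (step t).

Lemma step_count_gt t : expR (t ^+ 2)^-1 < step_count t.
Proof. by have := floorD1_gt (expR (t ^+ 2)^-1); rewrite intrD. Qed.

Lemma step_count_gt0 t : 0 < step_count t.
Proof. exact: lt_trans (expR_gt0 _) (step_count_gt t). Qed.

Lemma step_le t : step t <= t ^+ 2.
Proof. by rewrite /step ler_pdivrMr ?step_count_gt0// floor_le. Qed.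

Lemma step_gt t : t ^+ 2 - (step_count t)^-1 < step t.
Proof.
have N0 := step_count_gt0 t.
rewrite /step ltr_pdivlMr// mulrBl mulVf ?gt_eqF// ltrBlDr.
by have := floorD1_gt (t ^+ 2 * step_count t); rewrite intrD.
Qed.

Lemma step_ge0 t : 0 <= step t.
Proof.
have N0 := step_count_gt0 t.
rewrite divr_ge0 ?(ltW N0)// ler0z floor_ge0.
by rewrite mulr_ge0 ?sqr_ge0// ltW.
Qed.

(** Rational abscissae give [curve] a countable range, which is what makes the measure singular. *)
Lemma step_rat t : exists q : rat, step t = ratr q.
Proof.
exists ((Num.floor (t ^+ 2 * step_count t))%:~R /
  ((Num.floor (expR (t ^+ 2)^-1))%:~R + 1)).
by rewrite fmorph_div/= rmorphD/= !ratr_int rmorph1.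
Qed.

Lemma measurable_step : measurable_fun setT step.
Proof.
have mt : measurable_fun setT (fun t : R => t ^+ 2) by exact: measurable_funX.
have mN : measurable_fun setT step_count.
  apply: measurable_funD => //; apply: measurable_fun_floor.
  apply: (measurableT_comp (@measurable_expR R)).
  by apply: ge0_measurable_funV => // t; exact: sqr_ge0.
apply: measurable_funM.
  by apply: measurable_fun_floor; exact: measurable_funM.
by apply: ge0_measurable_funV => // t; rewrite ltW// step_count_gt0.
Qed.

Lemma measurable_sqrtr : measurable_fun setT (@Num.sqrt R).
Proof. by apply: continuous_measurable_fun; exact: sqrt_continuous. Qed.

Lemma measurable_curve : measurable_fun setT curve.
Proof.
apply: measurable_fun_pair; first exact: measurable_step.
apply: (measurableT_comp measurable_sqrtr).
apply: measurable_funB => //; apply: measurable_funX; exact: measurable_step.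
Qed.

Lemma circleE (p : plane R) : circle p <-> p.1 ^+ 2 + p.2 ^+ 2 = 1.
Proof.
have -> : circle p = (cabs (toC p) = 1) by [].
have <- : cabs (toC p) ^+ 2 = p.1 ^+ 2 + p.2 ^+ 2 by rewrite cabs_sqr.
split => [->|/eqP]; first by rewrite expr1n.
by rewrite sqrp_eq1 ?cabs_ge0// => /eqP.
Qed.

Lemma measurable_circle : measurable (@circle R).
Proof.
have m1 : measurable_fun setT (fun p : plane R => p.1 ^+ 2 + p.2 ^+ 2).
  by apply: measurable_funD; apply: measurable_funX.
have := m1 measurableT _ (measurable_set1 (1 : R)).
by rewrite setTI; congr measurable; apply/seteqP; split => p /circleE.
Qed.

Lemma circle_circle_graph x : x ^+ 2 <= 1 -> circle (circle_graph x).
Proof.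
by move=> x1; apply/circleE => /=; rewrite sqr_sqrtr ?subr_ge0// addrC subrK.
Qed.

(** For t below 1/2 the abscissa [step t] is at most t^2 < 1/4, so [curve t] does lie on the
    circle. *)
Definition step_measure (A : set (plane R)) : \bar R :=
  lebesgue_measure (`[0, 2^-1[ `&` curve @^-1` A).

Let m_preim (A : set (plane R)) : measurable A ->
  measurable (`[0, 2^-1[ `&` curve @^-1` A).
Proof.
move=> mA; apply: measurableI; first exact: measurable_itv.
by rewrite -[X in measurable X]setTI; exact: measurable_curve.
Qed.

Let step_measure0 : step_measure set0 = 0%E.
Proof. by rewrite /step_measure preimage_set0 setI0 measure0. Qed.

Let step_measure_ge0 A : (0 <= step_measure A)%E.
Proof. exact: measure_ge0. Qed.

Let step_measure_sigma_additive : semi_sigma_additive step_measure.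
Proof.
move=> F mF tF mUF; rewrite /step_measure preimage_bigcup setI_bigcupr.
apply: measure_semi_sigma_additive.
- by move=> n; exact: m_preim.
- apply/trivIsetP => /= i j _ _ ij.
  rewrite setIACA -(preimage_setI curve (F i)).
  by move/trivIsetP : tF => /(_ _ _ _ _ ij) ->//; rewrite preimage_set0 setI0.
- by rewrite -setI_bigcupr -preimage_bigcup; exact: m_preim.
Qed.

HB.instance Definition _ := isMeasure.Build _ _ _ step_measure
  step_measure0 step_measure_ge0 step_measure_sigma_additive.

Let step_measure_fin : fin_num_fun step_measure.
Proof.
move=> A mA; rewrite ge0_fin_numE//.
apply: (@le_lt_trans _ _ (lebesgue_measure (`[0, 2^-1[%classic : set R))).
  apply: le_measure; rewrite ?inE; first exact: m_preim.
  - exact: measurable_itv.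
  - exact: subIsetl.
by rewrite lebesgue_measure_itv/=; case: ifP => _; rewrite ?ltry// -EFinD ltry.
Qed.

HB.instance Definition _ :=
  @Measure_isFinite.Build _ _ _ step_measure step_measure_fin.

(** If t < t', then (t' - t) / 2 lies strictly between 0 and pi and has positive sine; but cos (t' -
    t) = 1, so the double angle formula makes that sine 0. *)
Lemma cos_sin_inj (t t' : R) : 0 <= t < 2 * pi -> 0 <= t' < 2 * pi ->
  cos t = cos t' -> sin t = sin t' -> t = t'.
Proof.
wlog tt' : t t' / t <= t' => [hw t2 t2' ct st|].
  by have [/hw|/ltW /hw] := leP t t'; [apply|move=> h; apply/esym/h].
move=> /andP[t0 _] /andP[_ t2'] ct st; apply/eqP; rewrite eq_le tt'/=.
rewrite leNgt; apply/negP => lt.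
have : cos (t' - t) = 1 by rewrite cosB ct st -!expr2 cos2Dsin2.
have -> : t' - t = ((t' - t) / 2) *+ 2 by rewrite -mulr_natr divfK.
rewrite cos_mulr2n => h.
have s0 : 0 < sin ((t' - t) / 2).
  by apply: sin_gt0_pi; apply/andP; split; lra.
have : 0 < sin ((t' - t) / 2) ^+ 2 by rewrite exprn_gt0.
have := cos2Dsin2 ((t' - t) / 2); move: h; rewrite -mulr_natl; lra.
Qed.

Lemma step_measure_singular : singular_on_circle step_measure.
Proof.
have c01 t : `[0, 2^-1[%classic t -> circle (curve t).
  rewrite /= in_itv/= => /andP[t0 t2]; apply: circle_circle_graph.
  rewrite expr_le1 ?step_ge0//; apply: le_trans (step_le t) _.
  by rewrite expr_le1//; lra.
split.
  rewrite /= /step_measure (_ : _ `&` _ = set0) ?measure0//.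
  by apply/seteqP; split => // t [/c01 + /=].
(* The separating set: it contains every value of [curve], and each of its countably many points has
   at most one angle in [0, 2 pi[, so its arclength is 0. *)
pose C := \bigcup_(q in [set: rat]) [set circle_graph (ratr q)].
exists C; split.
- apply: bigcupT_measurable_rat => q.
  have -> : [set circle_graph (ratr q)] =
      [set (circle_graph (ratr q)).1] `*` [set (circle_graph (ratr q)).2].
    by apply/seteqP; split => [p ->//|[a b] [/= -> ->]].
  by apply: measurableX; exact: measurable_set1.
- apply: countable_lebesgue_measure0.
  apply: (@sub_countable _ _ _ (\bigcup_(q in [set: rat]) (`[0, 2 * pi[ `&`
      [set t | (cos t, sin t) = circle_graph (ratr q)]))).
    by apply: subset_card_le => t [t2 [q _ tq]]; exists q.
  apply: bigcup_countable => // q _.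
  set F := _ `&` _; have [->|/set0P[t0 Ft0]] := eqVneq F set0.
    exact: countable0.
  apply: (@sub_countable _ _ _ [set t0]); last exact: countable1.
  apply: subset_card_le => t Ft /=.
  move: Ft Ft0 => [/=]; rewrite in_itv/= => t2 e.
  move=> [/=]; rewrite in_itv/= => t02 e0.
  by apply: cos_sin_inj => //; have := etrans e (esym e0) => -[].
- rewrite /= /step_measure (_ : _ `&` _ = set0) ?measure0//.
  apply/seteqP; split => // t [_ /=]; apply.
  by have [q qt] := step_rat t; exists q; rewrite //= /curve qt.
Qed.

End curve.

(** * Lower bounds for the Poisson integral *)

Section poisson.
Context {R : realType}.
Implicit Types (z : R[i]) (p : plane R).

(** The Poisson kernel: once 1 is replaced by |p|^2, this is a polynomial identity in the
    coordinates and the inverse of |p - z|^2. *)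
Lemma Re_div_addB z p : cabs z < 1 -> circle p ->
  complex.Re ((toC p + z) / (toC p - z)) =
  (1 - cabs z ^+ 2) / cabs (toC p - z) ^+ 2.
Proof.
move=> z1 /circleE; rewrite !cabs_sqr; case: p z z1 => [p1 p2] [x y] /= z1 <-.
ring.
Qed.

Lemma cabs_singular_inner (nu : {finite_measure set (plane R) -> \bar R}) z :
  cabs z < 1 ->
  cabs (singular_inner nu z) = expR (- fine (\int[nu]_(p in circle)
    ((1 - cabs z ^+ 2) / cabs (toC p - z) ^+ 2)%:E)%E).
Proof.
move=> z1; rewrite cabs_cexp /=; congr (expR (- _)).
rewrite /Rintegral; congr fine; apply: eq_integral => p /[!inE] cp.
by rewrite -(Re_div_addB z1 cp).
Qed.

(** Markov's inequality on the set where the Poisson kernel is at least c. *)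
Lemma poisson_integral_markov (nu : {finite_measure set (plane R) -> \bar R})
    z (c : R) : cabs z < 1 -> 0 < c ->
  (c%:E * nu (circle `&`
      [set p | (c * cabs (toC p - z) ^+ 2 <= 1 - cabs z ^+ 2)%R]) <=
  (fine (\int[nu]_(p in circle)
    ((1 - cabs z ^+ 2) / cabs (toC p - z) ^+ 2)%:E))%:E)%E.
Proof.
move=> z1 c0; set E := _ `&` _.
have v0 : 0 <= 1 - cabs z ^+ 2 by rewrite subr_ge0 expr_le1 ?cabs_ge0// ltW.
have D0 p : circle p -> 1 - cabs z <= cabs (toC p - z).
  by move=> cp; have := ler_cabs_sub (toC p) z; rewrite [X in X - _]cp.
have d0 : 0 < 1 - cabs z by rewrite subr_gt0.
have mE : measurable E.
  apply: measurable_fun_le => //; first exact: measurable_circle.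
  have -> : (fun p : plane R => c * cabs (toC p - z) ^+ 2) =
      (fun p => c * ((p.1 - complex.Re z) ^+ 2 + (p.2 - complex.Im z) ^+ 2)).
    by apply/funext => -[a b]; rewrite cabs_sqr; case: (z).
  apply: measurable_funTS; apply: measurable_funM => //.
  by apply: measurable_funD; apply: measurable_funX; apply: measurable_funB.
have F0 p : circle p -> (0 <= ((1 - cabs z ^+ 2) / cabs (toC p - z) ^+ 2)%:E)%E.
  by move=> _; rewrite lee_fin divr_ge0// sqr_ge0.
have fin_nu A : measurable A -> nu A \is a fin_num.
  by move=> mA; exact: fin_num_measure.
(* An upper bound showing that the integral is finite; otherwise [fine] would return 0 and the lower
   bound would be lost. *)
have : (\int[nu]_(p in circle)
    ((1 - cabs z ^+ 2) / cabs (toC p - z) ^+ 2)%:E <=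
    ((1 - cabs z ^+ 2) / (1 - cabs z) ^+ 2)%:E * nu circle)%E.
  rewrite -integral_cst//; last exact: measurable_circle.
  apply: ge0_le_integral_nonmeasurable => //.
    by move=> p _; rewrite lee_fin divr_ge0// sqr_ge0.
  move=> p cp; rewrite lee_fin ler_wpM2l// lef_pV2 ?posrE ?exprn_gt0//.
    by rewrite ler_pXn2r ?nnegrE ?cabs_ge0 ?D0// ltW.
  exact: lt_le_trans (D0 _ cp).
have : (c%:E * nu E <= \int[nu]_(p in circle)
    ((1 - cabs z ^+ 2) / cabs (toC p - z) ^+ 2)%:E)%E.
  rewrite -integral_cst//; apply: ge0_le_integral_nonmeasurable => //.
  - by move=> p _; rewrite lee_fin ltW.
  - by move=> p [].
  - move=> p [cp h]; rewrite lee_fin ler_pdivlMr// exprn_gt0//.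
    exact: lt_le_trans (D0 _ cp).
have nuc := fin_nu _ measurable_circle.
set I := (\int[nu]_(_ in _) _)%E => h1 h2.
have If : I \is a fin_num.
  rewrite ge0_fin_numE ?integral_ge0//; apply: le_lt_trans h2 _.
  by rewrite -(fineK nuc) -EFinM ltry.
by rewrite fineK.
Qed.

End poisson.

(** * Smallness of the singular inner function near the point (0, 1) *)

Section step_measure_estimates.
Context {R : realType}.
Implicit Types (x u : R) (n : nat).

(** For abscissae in [0, 1/4] both ordinates are at least 1/2, so the arc is 1-Lipschitz there. The
    horizontal gap is at most 3u and the vertical one at most 3u + u = 4u, whence 9 + 16 = 25. *)
Lemma sqr_dist_circle_graph (g x u : R) :
  0 <= g <= x -> x <= 4^-1 -> x - g <= 3 * u ->
  (g - x) ^+ 2 +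
  (Num.sqrt (1 - g ^+ 2) - (Num.sqrt (1 - x ^+ 2) - u)) ^+ 2 <= 25 * u ^+ 2.
Proof.
move=> /andP[g0 gx] x4 xg.
have x0 := le_trans g0 gx.
have half (y : R) : 0 <= y <= 4^-1 -> 2^-1 <= Num.sqrt (1 - y ^+ 2).
  move=> /andP[y0 y4].
  rewrite -(@ler_pXn2r _ 2) ?nnegrE ?sqrtr_ge0// ?invr_ge0//.
  by rewrite sqr_sqrtr; nra.
have : 2^-1 <= Num.sqrt (1 - g ^+ 2) by apply: half; rewrite g0/=; lra.
have : 2^-1 <= Num.sqrt (1 - x ^+ 2) by apply: half; rewrite x0/=; lra.
have sg : Num.sqrt (1 - g ^+ 2) ^+ 2 = 1 - g ^+ 2 by rewrite sqr_sqrtr//; nra.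
have sx : Num.sqrt (1 - x ^+ 2) ^+ 2 = 1 - x ^+ 2 by rewrite sqr_sqrtr//; nra.
set c := Num.sqrt _ in sx *; set c' := Num.sqrt _ in sg * => c2 c2'.
have e : (c' - c) * (c' + c) = (x - g) * (x + g).
  by transitivity (c' ^+ 2 - c ^+ 2); [ring|rewrite sg sx; ring].
have d0 : 0 <= c' - c.
  rewrite -(@pmulr_lge0 _ (c' + c)); last lra.
  by rewrite e mulr_ge0; lra.
have d1 : c' - c <= x - g.
  apply: (@le_trans _ _ ((c' - c) * (c' + c))); first by nra.
  by rewrite e; nra.
nra.
Qed.

(** As t^2 < x <= 1/n, the grid has N > exp (1 / t^2) >= e^n >= 2^n, so rounding costs less than
    2^-n < 2u, on top of x - t^2 <= u. *)
Lemma step_near n x u t : (3 < n)%N -> x <= n%:R^-1 -> 2^-1 ^+ n < 2 * u ->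
  0 < x - u <= t ^+ 2 -> t ^+ 2 < x -> x - step t <= 3 * u.
Proof.
move=> n3 xn un /andP[xu0 xut] tx.
have t20 : 0 < t ^+ 2 by lra.
have n0' : (0 < n)%N by exact: ltn_trans n3.
have n0 : 0 < n%:R :> R by rewrite ltr0n.
have nt : n%:R <= (t ^+ 2)^-1.
  by rewrite -[n%:R]invrK lef_pV2 ?posrE ?invr_gt0//; lra.
have : 2 ^+ n <= expR (t ^+ 2)^-1.
  apply: (@le_trans _ _ (expR n%:R)); last by rewrite ler_expR.
  rewrite -[n%:R]mulr1 expRM_natl.
  rewrite ler_pXn2r ?nnegrE ?expR_ge0//.
  by have := expR_ge1Dx (1 : R); lra.
move=> h.
have N : 2 ^+ n <= step_count t by apply: le_trans h (ltW (step_count_gt t)).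
have : (step_count t)^-1 <= 2^-1 ^+ n.
  by rewrite exprVn lef_pV2 ?posrE ?exprn_gt0// step_count_gt0.
have := step_gt t; lra.
Qed.

(** All parameters t in [sqrt (x - u), sqrt x[ are sent within distance 5u of the given point, so
    the mass is at least the length of this interval. *)
Lemma step_measure_arc_ge n x u : (3 < n)%N -> 0 < x - u -> x <= n%:R^-1 ->
  0 < u -> 2^-1 ^+ n < 2 * u ->
  ((Num.sqrt x - Num.sqrt (x - u))%:E <=
    step_measure (circle `&` [set p : plane R | (cabs (toC p -
      toC (x, Num.sqrt (1 - x ^+ 2) - u)) ^+ 2 <= 25 * u ^+ 2)%R]))%E.
Proof.
move=> n3 xu xn u0 un.
have x0 : 0 < x by lra.
have n0 : (0 < n)%N by exact: ltn_trans n3.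
have x4 : x <= 4^-1.
  apply: le_trans xn _; rewrite lef_pV2 ?posrE ?ltr0n//.
  by rewrite (ler_nat _ 4).
have s12 : Num.sqrt (x - u) < Num.sqrt x by rewrite ltr_sqrt// gtrBl.
have s2 : Num.sqrt x <= 2^-1.
  rewrite -(@ler_pXn2r _ 2) ?nnegrE ?sqrtr_ge0 ?invr_ge0//.
  by rewrite (sqr_sqrtr (ltW x0)); lra.
have -> : (Num.sqrt x - Num.sqrt (x - u))%:E =
    lebesgue_measure `[Num.sqrt (x - u), Num.sqrt x[%classic.
  by rewrite lebesgue_measure_itv/= lte_fin s12 EFinB.
set E := _ `&` _.
suff sub : `[Num.sqrt (x - u), Num.sqrt x[%classic `<=`
    `[0, 2^-1[%classic `&` curve @^-1` E.
  apply: le_outer_measure; exact: sub.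
move=> t /=; rewrite !in_itv/= => /andP[t1 t2].
have t0 : 0 <= t by apply: le_trans t1; exact: sqrtr_ge0.
have t1' : x - u <= t ^+ 2.
  by rewrite -(sqr_sqrtr (ltW xu)) ler_pXn2r ?nnegrE ?sqrtr_ge0.
have t2' : t ^+ 2 < x.
  by rewrite -[ltRHS](sqr_sqrtr (ltW x0)) ltr_pXn2r ?nnegrE ?sqrtr_ge0.
have sx : x - step t <= 3 * u.
  by apply: (step_near n3 xn un) => //; rewrite xu.
have s0 := step_ge0 t; have st := step_le t.
split; first by rewrite t0/=; apply: lt_le_trans s2.
split; first by apply: circle_circle_graph; nra.
rewrite /= cabs_sqr /=; apply: sqr_dist_circle_graph => //.
by rewrite s0/=; lra.
Qed.

Lemma singular_inner_step_measure_le n x u :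
  (3 < n)%N -> 0 < x - u -> x <= n%:R^-1 -> 0 < u <= 4^-1 ->
  2^-1 ^+ n < 2 * u ->
  let z := toC (x, Num.sqrt (1 - x ^+ 2) - u) in
  [/\ u <= 1 - cabs z ^+ 2, 1 - cabs z ^+ 2 <= 2 * u, cabs z < 1 &
    cabs (singular_inner (step_measure (R:=R)) z) <=
    expR (- (50 * Num.sqrt x)^-1)].
Proof.
move=> n3 xu xn /andP[u0 u4] un z.
have x0 : 0 < x by lra.
have n0 : (0 < n)%N by exact: ltn_trans n3.
have x4 : x <= 4^-1.
  apply: le_trans xn _; rewrite lef_pV2 ?posrE ?ltr0n//.
  by rewrite (ler_nat _ 4).
have sx : Num.sqrt (1 - x ^+ 2) ^+ 2 = 1 - x ^+ 2 by rewrite sqr_sqrtr//; nra.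
have zE : 1 - cabs z ^+ 2 = u * (2 * Num.sqrt (1 - x ^+ 2) - u).
  rewrite cabs_sqr/= sqrrB sx; ring.
have c1 : Num.sqrt (1 - x ^+ 2) <= 1.
  by rewrite -(@ler_pXn2r _ 2) ?nnegrE ?sqrtr_ge0// sx expr1n; nra.
have c2 : 3 / 4 <= Num.sqrt (1 - x ^+ 2).
  by rewrite -(@ler_pXn2r _ 2) ?nnegrE ?sqrtr_ge0 ?divr_ge0// sx; nra.
have v1 : u <= 1 - cabs z ^+ 2 by rewrite zE; nra.
have v2 : 1 - cabs z ^+ 2 <= 2 * u by rewrite zE; nra.
have z1 : cabs z < 1.
  by rewrite -(@ltr_pXn2r _ 2) ?nnegrE ?cabs_ge0// expr1n; lra.
split => //.
rewrite cabs_singular_inner// ler_expR lerN2.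
(* Within distance 5u of z the kernel is at least u / (25 u^2) = 1 / (25u). The mass there is at
   least sqrt x - sqrt (x - u) >= u / (2 sqrt x), and the product of the two bounds is 1 / (50 sqrt
   x). *)
have cu0 : 0 < (25 * u)^-1 by rewrite invr_gt0 mulr_gt0.
rewrite -lee_fin; apply: le_trans (poisson_integral_markov _ z1 cu0).
apply: (@le_trans _ _ ((25 * u)^-1%:E * (Num.sqrt x - Num.sqrt (x - u))%:E)%E).
  rewrite -EFinM lee_fin.
  have s1 : Num.sqrt (x - u) ^+ 2 = x - u by rewrite sqr_sqrtr// ltW.
  have s2 : Num.sqrt x ^+ 2 = x by rewrite sqr_sqrtr// ltW.
  have s0 : 0 < Num.sqrt x by rewrite sqrtr_gt0.
  have s0' : 0 < Num.sqrt (x - u) by rewrite sqrtr_gt0.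
  set a := Num.sqrt x in s2 s0 *; set b := Num.sqrt (x - u) in s1 s0' *.
  have -> : a - b = u / (a + b).
    have <- : (a - b) * (a + b) = u by rewrite -subr_sqr s1 s2; ring.
    by rewrite mulfK// lt0r_neq0// addr_gt0.
  have -> : (25 * u)^-1 * (u / (a + b)) = (25 * (a + b))^-1.
    by field; rewrite !lt0r_neq0// addr_gt0.
  rewrite lef_pV2 ?posrE ?mulr_gt0 ?addr_gt0//.
  have : b < a by rewrite ltr_sqrt// gtrBl.
  lra.
apply: lee_wpmul2l; first by rewrite lee_fin ltW.
apply: le_trans (step_measure_arc_ge n3 xu xn u0 un) _.
apply: le_outer_measure => t [t2 [ct /= h]]; split => //; split => //=.
rewrite ler_pdivrMl ?mulr_gt0//; apply: le_trans h _.
by rewrite expr2 mulrA ler_wpM2l// mulr_ge0// ltW.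
Qed.

End step_measure_estimates.

(** * The area condition *)

(** Keeps the height of the n-th box, at most 2^-n, below its least abscissa 1 / (2n). *)
Lemma ltn_double_exp2 n : (3 < n)%N -> (2 * n < 2 ^ n)%N.
Proof.
elim: n => // n IH; rewrite ltnS leq_eqVlt => /predU1P[<-//|/[dup] n3 /IH].
by rewrite expnS; lia.
Qed.

Section area.
Context {R : realType}.
Implicit Types (n : nat) (p : plane R).

(* Boxes along the circle next to the point (0, 1), at height about 2^-n. *)
Definition near_arc n : set (plane R) :=
  [set p | (2 * n%:R)^-1 <= p.1 <= n%:R^-1 /\
    2^-1 ^+ n.+1 < Num.sqrt (1 - p.1 ^+ 2) - p.2 <= 2^-1 ^+ n].

Lemma measurable_near_arc n : measurable (near_arc n).
Proof.
have mg : measurable_fun setT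
    (fun p : plane R => Num.sqrt (1 - p.1 ^+ 2) - p.2).
  apply: measurable_funB => //.
  apply: (measurableT_comp measurable_sqrtr).
  by apply: measurable_funB => //; apply: measurable_funX.
have -> : near_arc n = (fst @^-1` `[(2 * n%:R)^-1, n%:R^-1]%classic) `&`
    ((fun p : plane R => Num.sqrt (1 - p.1 ^+ 2) - p.2) @^-1`
       `]2^-1 ^+ n.+1, 2^-1 ^+ n]%classic).
  by apply/seteqP; split => p /=; rewrite !in_itv.
apply: measurableI.
  rewrite -[X in measurable X]setTI.
  by apply: (@measurable_fst _ _ (measurableTypeR R) (measurableTypeR R));
    [exact: measurableT|exact: measurable_itv].
rewrite -[X in measurable X]setTI.
by apply: mg; [exact: measurableT|exact: measurable_itv].
Qed.

(** The box is curved, but its vertical sections all have length 2^-(n+1), over an interval of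
    abscissae of length 1 / (2n). *)
Lemma m2_near_arc n : (0 < n)%N ->
  m2 (near_arc n) = ((2 * n%:R)^-1 * 2^-1 ^+ n.+1)%:E.
Proof.
move=> n0; have nR : 0 < n%:R :> R by rewrite ltr0n.
pose I : set R := `[(2 * n%:R)^-1, n%:R^-1]%classic.
have h0 : 0 < 2^-1 ^+ n.+1 :> R by rewrite exprn_gt0// invr_gt0.
have secE x : lebesgue_measure (xsection (near_arc n) x) =
    ((2^-1 ^+ n.+1)%:E * (\1_I x)%:E)%E.
  have [xI|xI] := boolP (x \in I); last first.
    rewrite indicE (negbTE xI) mule0 (_ : xsection _ _ = set0) ?measure0//.
    apply/seteqP; split => // y; rewrite /xsection/= inE => -[/= xn _].
    by move: xI; rewrite notin_setE /I/= in_itv/=; apply.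
  rewrite indicE xI mule1; set c := Num.sqrt (1 - x ^+ 2).
  rewrite (_ : xsection _ _ = `[c - 2^-1 ^+ n, c - 2^-1 ^+ n.+1[%classic);
      last first.
    apply/seteqP; split => y; rewrite /xsection/= inE/= in_itv/=.
      by move=> [/= _ /andP[h1 h2]]; apply/andP;
        split; rewrite -/c in h1 h2; lra.
    move=> /andP[h1 h2]; split => /=.
      by move: xI; rewrite inE /I/= in_itv.
    by rewrite -/c; apply/andP; split; lra.
  have hS : 2^-1 ^+ n.+1 = 2^-1 * 2^-1 ^+ n :> R by rewrite exprS.
  rewrite lebesgue_measure_itv/= lte_fin ifT; last by lra.
  by rewrite -EFinB; congr EFin; lra.
transitivity (\int[lebesgue_measure]_x
  lebesgue_measure (xsection (near_arc n) x))%E => //.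
under eq_integral do rewrite secE.
rewrite ge0_integralZl_EFin ?ltW//; last first.
  by apply/measurable_EFinP; apply: measurable_indic; exact: measurable_itv.
rewrite integral_indic//; last exact: measurable_itv.
rewrite setIT [X in (_ * X)%E]lebesgue_measure_itv/= lte_fin ifT.
  by rewrite -EFinB -EFinM; congr EFin; field; rewrite gt_eqF.
by rewrite ltf_pV2 ?posrE ?mulr_gt0//; lra.
Qed.

Lemma near_arc_disjoint n m : (m < n)%N -> near_arc m `&` near_arc n = set0.
Proof.
move=> mn; apply/seteqP; split => // p.
move=> [[_ /andP[h1 _]] [_ /andP[_ h2]]].
suff : 2^-1 ^+ n <= 2^-1 ^+ m.+1 :> R by lra.
by apply: ler_wiXn2l => //; lra.
Qed.

Lemma near_arc_bound (L : R) : 0 < L -> exists n0, forall n p, (n0 <= n)%N ->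
  near_arc n p ->
  [/\ (3 < n)%N, disc (toC p),
      cabs (singular_inner (step_measure (R:=R)) (toC p)) < expR (- L) &
      2 ^+ n / 2 <= (1 - cabs (toC p))^-1].
Proof.
(* For n >= M > (50 L)^2 and x <= 1/n, the exponent 1 / (50 sqrt x) exceeds L. *)
move=> L0; pose M := Num.bound ((50 * L) ^+ 2).
exists (maxn 4 M) => n [x y]; rewrite geq_max => /andP[n4 Mn].
move=> [/= /andP[xn1 xn2] /andP[un1 un2]].
have n0 : 0 < n%:R :> R by rewrite ltr0n; exact: leq_trans n4.
have h0 : 0 < 2^-1 ^+ n :> R by rewrite exprn_gt0// invr_gt0.
set u := Num.sqrt (1 - x ^+ 2) - y in un1 un2.
have u2 : 2^-1 ^+ n < 2 * u by move: un1; rewrite exprS; lra.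
have h4 : 2^-1 ^+ n <= 4^-1 :> R.
  apply: (@le_trans _ _ (2^-1 ^+ 2)); last by lra.
  by apply: ler_wiXn2l; [lra|lra|exact: leq_trans n4].
have xu : 0 < x - u.
  rewrite subr_gt0; apply: le_lt_trans un2 (lt_le_trans _ xn1).
  rewrite exprVn ltf_pV2 ?posrE ?exprn_gt0 ?mulr_gt0// -natrX -natrM ltr_nat.
  exact: ltn_double_exp2.
have u01 : 0 < u <= 4^-1 by lra.
have := singular_inner_step_measure_le n4 xu xn2 u01 u2.
rewrite (_ : Num.sqrt (1 - x ^+ 2) - u = y); last by rewrite /u; ring.
set z := toC (x, y) => -[v1 v2 z1 Sz].
split => //.
  apply: le_lt_trans Sz _; rewrite ltr_expR ltrN2.
  have x0 : 0 < x by lra.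
  have s0 : 0 < Num.sqrt x by rewrite sqrtr_gt0.
  rewrite -[L]invrK ltf_pV2 ?posrE ?invr_gt0 ?mulr_gt0//.
  rewrite -[ltRHS]mul1r ltr_pdivlMr//.
  rewrite -(@ltr_pXn2r _ 2) ?nnegrE ?mulr_ge0 ?ltW// expr1n.
  have -> : (50 * Num.sqrt x * L) ^+ 2 = (50 * L) ^+ 2 * x.
    by rewrite !exprMn sqr_sqrtr ?ltW//; ring.
  rewrite -ltr_pdivlMr// mul1r.
  apply: (@lt_le_trans _ _ n%:R); last first.
    by rewrite -[n%:R]invrK lef_pV2 ?posrE ?invr_gt0.
  apply: (@lt_le_trans _ _ M%:R); last by rewrite ler_nat.
  by apply: archi_boundP; exact: sqr_ge0.
(* The weight bound rests on 1 - |z| <= 1 - |z|^2 <= 2u <= 2 * 2^-n. *)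
have z0 := cabs_ge0 z.
rewrite -[leLHS]invrK lef_pV2 ?posrE ?invr_gt0 ?subr_gt0 ?divr_gt0 ?exprn_gt0//.
rewrite invfM invrK -exprVn.
by nra.
Qed.

Lemma step_measure_area : area_condition (singular_inner (step_measure (R:=R))).
Proof.
move=> eps /andP[e0 e1].
have [|n0 hn0] := @near_arc_bound (- ln eps).
  by rewrite oppr_gt0 ln_lt0// e0.
pose F k := near_arc (n0 + k).+1.
have hF k p : F k p ->
  [/\ (3 < (n0 + k).+1)%N, disc (toC p),
      cabs (singular_inner (step_measure (R:=R)) (toC p)) < eps &
      2 ^+ (n0 + k).+1 / 2 <= (1 - cabs (toC p))^-1].
  move=> Fp; have [|n3 z1 + h] := @hn0 (n0 + k).+1 p _ Fp.
    by rewrite leqW// leq_addr.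
  by rewrite opprK lnK.
(* The absolute value makes the weight nonnegative on the whole plane, so that [ge0_measurable_funV]
   applies; inside the disc nothing changes. *)
pose f p : R := `|1 - cabs (toC p)|^-1.
have fE p : disc (toC p) -> f p = (1 - cabs (toC p))^-1.
  by move=> p1; rewrite /f ger0_norm// subr_ge0 ltW.
have mf : measurable_fun setT f.
  apply: ge0_measurable_funV => //; apply: measurableT_comp => //.
  apply: measurable_funB => //.
  have -> : (fun p : plane R => cabs (toC p)) =
      (fun p => Num.sqrt (p.1 ^+ 2 + p.2 ^+ 2)).
    by apply/funext => p; rewrite cabsE.
  apply: (measurableT_comp measurable_sqrtr).
  by apply: measurable_funD; apply: measurable_funX.
set A := [set p | _].
have f0 p : (0 <= (f p)%:E)%E by rewrite lee_fin invr_ge0.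
have mF k : measurable (F k) by exact: measurable_near_arc.
have : (\int[m2]_(p in \bigcup_k F k) (f p)%:E <=
    \int[m2]_(p in A) ((1 - cabs (toC p))^-1)%:E)%E.
  apply: ge0_le_integral_nonmeasurable => //.
  - by move=> p [p1 _]; rewrite lee_fin invr_ge0 subr_ge0 ltW.
  - by move=> p [k _ /hF[_ p1 Sp _]].
  - by move=> p [k _ /hF[_ p1 Sp _]]; rewrite fE.
rewrite ge0_integral_bigcup//; last 2 first.
- by apply: measurable_funTS; apply/measurable_EFinP.
- by apply: ltn_trivIset => k l kl; apply: near_arc_disjoint;
    rewrite ltnS ltn_add2l.
set s := (\sum_(_ <oo) _)%E => sle.
suff sy : s = +oo%E by apply/eqP; rewrite -leye_eq -sy.
apply/eqP; rewrite -leye_eq leNgt; apply/negP => sfin.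
(* A box of index n contributes at least (2^n / 2) * 2^-(n+1) / (2n) = 1 / (8n). With n = n0 + k + 1
   <= (n0 + 1)(k + 1), this is at least c / (k + 1). *)
pose c : R := (8 * n0.+1%:R)^-1.
have c0 : 0 < c by rewrite invr_gt0 mulr_gt0.
have harm k : ((c * harmonic k)%:E <= \int[m2]_(p in F k) (f p)%:E)%E.
  set n := (n0 + k).+1.
  apply: (@le_trans _ _ (\int[m2]_(p in F k) (2 ^+ n / 2)%:E)%E); last first.
    apply: ge0_le_integral_nonmeasurable => //.
    by move=> p /hF[_ p1 _ h]; rewrite fE.
  rewrite integral_cst// /F m2_near_arc// -EFinM lee_fin -/n.
  have -> : 2 ^+ n / 2 * ((2 * n%:R)^-1 * 2^-1 ^+ n.+1) = (8 * n%:R)^-1 :> R.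
    rewrite exprS exprVn; field.
    by rewrite pnatr_eq0/= expf_neq0.
  rewrite /c /harmonic/= -invfM lef_pV2 ?posrE ?mulr_gt0//.
  by rewrite -mulrA ler_pM2l// -natrM ler_nat /n; lia.
(* A finite s would bound all harmonic partial sums by s / c, so the harmonic series would
   converge. *)
apply: (@dvg_harmonic R); apply: nondecreasing_is_cvgn.
  by apply: nondecreasing_series => k _ _; exact: harmonic_ge0.
exists (fine s / c) => _ [m _ <-]; rewrite ler_pdivlMr// -lee_fin fineK;
    last first.
  by rewrite ge0_fin_numE// nneseries_ge0// => k _ _; exact: integral_ge0.
rewrite /series/= mulr_suml -sumEFin.
apply: (@le_trans _ _ (\sum_(0 <= k < m) \int[m2]_(p in F k) (f p)%:E)%E).
  by apply: lee_sum => k _; rewrite mulrC; exact: harm.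
by apply: nneseries_lim_ge => k _ _; exact: integral_ge0.
Qed.

End area.

Theorem theorem5 (R : realType) :
  exists nu : {finite_measure set (plane R) -> \bar R},
    [/\ singular_on_circle nu,
        area_condition (singular_inner nu) &
        ~ exists2 B : R[i] -> R[i],
            is_blaschke_product B &
            generalized_Carleson_Newman (fun z => B z * singular_inner nu z)].
Proof.
exists (step_measure (R:=R)); split.
- exact: step_measure_singular.
- exact: step_measure_area.
- move=> [B BB]; apply: not_generalized_Carleson_Newman BB _ step_measure_area.
  by move=> z; exact: cexp_neq0.
Qed.
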